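(* The linear transformation $\mathbb{Q}[x]\to\mathbb{Q}[x]$ given by $x^n\mapsto\widetilde{Q}_n(x)$ for all $n\geq 0$ takes $B_n(x^2)$ into $x^{2n}$ for all $n\geq 1$, and takes $x\,b_n(x^2)$ into $x^{2n+1}$ for all $n\geq 0$, where $$B_n(x)=\sum_{k=1}^{n}\binom{n-1+k}{n-k}x^k\quad(n\geq 1),\qquad b_n(x)=\sum_{k=0}^{n}\binom{n+k}{n-k}x^k\quad(n\geq 0).$$
   Context: The polynomials $\widetilde{Q}_n(x)$ are given by $\widetilde{Q}_0(x)=1$ and $$ \widetilde{Q}_n(x)=\sum_{j=0}^{\left\lfloor \frac{n-1}{2}\right\rfloor}(-1)^j \left(\binom{n-1}{j}-\binom{n-1}{j-1}\right)x^{n-2j}\quad\text{for } n\geq 1, $$ with the convention $\binom{m}{-1}=0$. The polynomials $B_n$ and $b_n$ are (up to the normalization used in the claim) the Morgan-Voyce polynomials. *)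

(* Defs.v *)
From HB Require Import structures.
From mathcomp Require Import all_boot all_order all_algebra.
Set Implicit Arguments.
Unset Strict Implicit.
Unset Printing Implicit Defensive.
Import GRing.Theory.
Local Open Scope ring_scope.

(* 'C(m, j - 1), with the convention 'C(m, -1) = 0; plain truncated
   subtraction would wrongly give 'C(m, 0) = 1 at j = 0. *)
Definition binom_pred (m j : nat) : nat :=
  if j is i.+1 then 'C(m, i) else 0%N.

Definition Qtilde (n : nat) : {poly rat} :=
  if n is 0 then 1 else
    \sum_(0 <= j < (n.-1)./2.+1)
      ((-1) ^+ j * ('C(n.-1, j)%:R - (binom_pred n.-1 j)%:R)) *: 'X^(n - 2 * j).

(* Only meaningful for 1 <= n. *)
Definition MVB (n : nat) : {poly rat} :=
  \sum_(1 <= k < n.+1) ('C(n.-1 + k, n - k))%:R *: 'X^k.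

Definition MVb (n : nat) : {poly rat} :=
  \sum_(0 <= k < n.+1) ('C(n + k, n - k))%:R *: 'X^k.

(* A linear map on {poly rat} with prescribed values on the monomials exists
   and is unique, so quantifying over such maps speaks of exactly one map. *)
Lemma linear_poly_exists (f : nat -> {poly rat}) :
  exists T : {linear {poly rat} -> {poly rat}}, forall n, T 'X^n = f n.
Proof.
pose T (p : {poly rat}) : {poly rat} := \sum_(i < size p) p`_i *: f i.
have TE m (p : {poly rat}) : (size p <= m)%N -> T p = \sum_(i < m) p`_i *: f i.
  move=> le_pm; rewrite /T (big_ord_widen _ (fun i => p`_i *: f i) le_pm).
  rewrite [RHS](bigID (fun i : 'I_m => (i < size p)%N)) /=.
  rewrite [X in _ = _ + X]big1 ?addr0 // => i.
  by rewrite -leqNgt => le_pi; rewrite nth_default // scale0r.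
have linT : linear T.
  move=> a p q; set m := maxn (size (a *: p + q)) (maxn (size p) (size q)).
  rewrite (TE m) ?leq_max ?leqnn // (TE m p) ?leq_max ?leqnn ?orbT //.
  rewrite (TE m q) ?leq_max ?leqnn ?orbT // scaler_sumr -big_split /=.
  by apply: eq_bigr => i _; rewrite coefD coefZ scalerDl scalerA.
pose linTM := GRing.isLinear.Build rat {poly rat} {poly rat} *:%R T linT.
pose LT : {linear {poly rat} -> {poly rat}} := HB.pack T linTM.
exists LT => n; rewrite /= (TE n.+1) ?size_polyXn // big_ord_recr /=.
rewrite coefXn eqxx scale1r big1 ?add0r // => i _.
by rewrite coefXn ltn_eqF ?scale0r.
Qed.

Lemma linear_poly_unique (T U : {linear {poly rat} -> {poly rat}}) :
  (forall n : nat, T 'X^n = U 'X^n) -> T =1 U.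
Proof.
move=> TU p; rewrite -[p]coefK poly_def !linear_sum.
by apply: eq_bigr => i _; rewrite !linearZ TU.
Qed.

(* Main.v *)
Require Import Defs.
From mathcomp Require Import all_boot all_order all_algebra.
From mathcomp Require Import ring zify.
Import GRing.Theory.
Local Open Scope ring_scope.

(** Both families are the even and odd members of one sequence satisfying
    [p_(m+1) = x p_m + p_(m-1)].  On the other side, Pascal's rule says that
    [T] intertwines multiplication by [x] with the map sending [x] to [x^2] and
    [x^m] to [x^(m+1) - x^(m-1)] for [m >= 2].  Hence [T p_m = x^m] propagates
    by induction along the recurrence. *)

(** For [2 * j <= n], the coefficient of ['X^(n.+1 - 2 * j)] in [Qtilde n.+1]; note the shift of the
    index. *)
Definition signed_ballot (n j : nat) : rat :=
  (-1) ^+ j * ('C(n, j)%:R - (binom_pred n j)%:R).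

Lemma signed_ballot0 (n : nat) : signed_ballot n 0 = 1.
Proof. by rewrite /signed_ballot bin0 subr0 mulr1. Qed.

Lemma signed_ballotS (n j : nat) :
  signed_ballot n.+1 j.+1 = signed_ballot n j.+1 - signed_ballot n j.
Proof.
rewrite /signed_ballot /binom_pred binS natrD exprS.
by case: j => [|j]; rewrite ?bin0 ?binS ?natrD; ring.
Qed.

(** The two middle binomials of an odd row agree by symmetry. *)
Lemma signed_ballot_mid (m : nat) : signed_ballot m.*2.+1 m.+1 = 0.
Proof.
rewrite /signed_ballot /binom_pred -(@bin_sub m.*2.+1 m.+1); last by lia.
by rewrite (_ : (m.*2.+1 - m.+1)%N = m) ?subrr ?mulr0 //; lia.
Qed.

(** Fixing the parity removes the floor from the summation range. *)
Lemma Qtilde_odd (m : nat) :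
  Qtilde m.*2.+1 = \sum_(j < m.+1) signed_ballot m.*2 j *: 'X^((m - j).*2.+1).
Proof.
rewrite /Qtilde /= doubleK big_mkord; apply: eq_bigr => j _.
by congr (_ *: 'X^_); have := ltn_ord j; lia.
Qed.

Lemma Qtilde_even (m : nat) :
  Qtilde m.*2.+2 =
  \sum_(j < m.+1) signed_ballot m.*2.+1 j *: 'X^((m - j).*2.+2).
Proof.
rewrite /Qtilde /= uphalf_double big_mkord; apply: eq_bigr => j _.
by congr (_ *: 'X^_); have := ltn_ord j; lia.
Qed.

Lemma coef1_Qtilde_odd (m : nat) : (Qtilde m.*2.+1)`_1 = signed_ballot m.*2 m.
Proof.
rewrite Qtilde_odd coef_sum big_ord_recr /= big1 => [|j _].
  by rewrite coefZ coefXn subnn mulr1 add0r.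
by rewrite coefZ coefXn (_ : (1 == _)%N = false) ?mulr0 //; have := ltn_ord j; lia.
Qed.

Lemma coef1_Qtilde_even (m : nat) : (Qtilde m.*2.+2)`_1 = 0.
Proof.
rewrite Qtilde_even coef_sum big1 // => j _.
by rewrite coefZ coefXn mulr0.
Qed.

(* Multiplied by ['X] to stay within polynomials: the right-hand side divided
   by ['X] sends x to x^2 and x^m to x^(m+1) - x^(m-1). *)
Lemma QtildeS (n : nat) :
  'X * Qtilde n.+2 = ('X^2 - 1) * Qtilde n.+1 + (Qtilde n.+1)`_1 *: 'X.
Proof.
have [|] := boolP (odd n) => odd_n; rewrite -[n]odd_double_half.
  rewrite odd_n add1n coef1_Qtilde_even scale0r addr0 -doubleS.
  rewrite Qtilde_odd Qtilde_even mulrBl mul1r !mulr_sumr.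
  set m := n./2.
  (* [Qtilde m.+1.*2.+1] has one term more than [Qtilde m.*2.+2]; padding with the vanishing middle
     coefficient aligns the sums. *)
  have -> : \sum_(j < m.+1)
              'X^2 * (signed_ballot m.*2.+1 j *: 'X^((m - j).*2.+2)) =
            \sum_(j < m.+2) signed_ballot m.*2.+1 j *: 'X^((m.+1 - j).*2.+2)
            :> {poly rat}.
    rewrite [in RHS]big_ord_recr /= signed_ballot_mid scale0r addr0.
    apply: eq_bigr => j _; rewrite -scalerAr -exprD.
    by congr (_ *: 'X^_); have := ltn_ord j; lia.
  rewrite big_ord_recl [in RHS]big_ord_recl !signed_ballot0 !scale1r -exprS.
  rewrite -addrA -sumrB; congr (_ + _).
  by apply: eq_bigr => j _; rewrite signed_ballotS -scalerAr -exprS -scalerBl.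
rewrite (negPf odd_n) add0n coef1_Qtilde_odd Qtilde_odd Qtilde_even.
set m := n./2; rewrite mulrBl mul1r !mulr_sumr.
(* The last term of the subtracted sum is its degree-one term, which the correction cancels; the
   remaining terms match by Pascal's rule after a shift of [j]. *)
rewrite big_ord_recl [in RHS]big_ord_recl [X in _ - X]big_ord_recr /=.
rewrite !signed_ballot0 subnn expr1 opprD !addrA subrK -addrA -sumrB.
rewrite !scale1r subn0 -exprS -exprD; congr (_ + _).
apply: eq_bigr => j _; rewrite signed_ballotS -!scalerAr scalerBl -exprS -exprD.
by congr (_ *: 'X^_ - _ *: 'X^_); rewrite /= /bump; have := ltn_ord j; lia.
Qed.

Lemma T_mulX (T : {linear {poly rat} -> {poly rat}})
    (hT : forall n : nat, T 'X^n = Qtilde n) (p : {poly rat}) :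
  'X * T ('X * p) = ('X^2 - 1) * T p + ((T p)`_1 *: 'X + (p`_0)%:P).
Proof.
rewrite -[p]coefK poly_def.
elim/big_rec: _ => [|[i /= _] q _ IHq] /=.
  by rewrite mulr0 !linear0 !coef0 scale0r !mulr0 !addr0.
rewrite mulrDr !linearD /= mulrDr IHq -scalerAr !linearZ /= -exprS !hT.
rewrite !(coefD, coefZ, coefXn) -scalerAr.
have -> : 'X * Qtilde i.+1 = ('X^2 - 1) * Qtilde i +
                            ((Qtilde i)`_1 *: 'X + (i == 0%N)%:R%:P).
  case: i => [|i] /=; last by rewrite addr0 QtildeS.
  rewrite big_nat1 coef1 scale0r add0r bin0 subr0 mulr1 scale1r /=.
  by rewrite -expr2 mulr1 subrK.
by rewrite [0%N == _]eq_sym polyCD polyCM -!mul_polyC polyCD polyCM; ring.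
Qed.

Lemma coef_MVb (n k : nat) :
  (MVb n)`_k = if (k <= n)%N then 'C(n + k, n - k)%:R else 0.
Proof.
rewrite /MVb big_mkord -(poly_def _ (fun k => 'C(n + k, n - k)%:R)).
by rewrite coef_poly ltnS.
Qed.

Lemma coef_MVB (n k : nat) :
  (MVB n.+1)`_k = if (k <= n.+1)%N then 'C(n + k, n.+1 - k)%:R else 0.
Proof.
rewrite -ltnS -(coef_poly n.+2 (fun k => 'C(n + k, n.+1 - k)%:R)) poly_def.
rewrite -(big_mkord xpredT (fun k => 'C(n + k, n.+1 - k)%:R *: 'X^k)).
(* The term [k = 0], absent from [MVB], would be ['C(n, n.+1) = 0]. *)
by rewrite big_nat_recl // bin_small ?addn0 // scale0r add0r /MVB big_add1.
Qed.

(** Pascal's rule on coefficients. At ['X^2] and multiplied by ['X], this is the recurrence step to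
    an odd index; [MVBS] gives the even ones. *)
Lemma MVbS (n : nat) : MVb n.+1 = MVB n.+1 + MVb n.
Proof.
apply/polyP => k; rewrite coefD !coef_MVb coef_MVB.
case: (ltngtP k n.+1) => [lt_kn|lt_nk|->].
- by rewrite -ltnS lt_kn subSn // addSn binS natrD.
- by rewrite leqNgt ltnW // addr0.
- by rewrite ltnn subnn !bin0 addr0.
Qed.

Lemma MVBS (n : nat) : MVB n.+2 = 'X * MVb n.+1 + MVB n.+1.
Proof.
apply/polyP => -[|k]; rewrite coefD coefXM !coef_MVB ?coef_MVb /=.
  by rewrite !bin_small ?addr0 //; lia.
rewrite ltnS; case: (ltngtP k n.+1) => [lt_kn|lt_nk|->].
- by rewrite !subSS addnS subSn // addSnnS addnS binS natrD.
- by rewrite addr0.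
- by rewrite !subnn !bin0 addr0.
Qed.

Lemma MVB1 : MVB 1 = 'X.
Proof. by rewrite /MVB big_nat1 scale1r. Qed.

Lemma MVb0 : MVb 0 = 1.
Proof. by rewrite /MVb big_nat1 scale1r. Qed.

Lemma T_MorganVoyce (T : {linear {poly rat} -> {poly rat}})
    (hT : forall n : nat, T 'X^n = Qtilde n) (n : nat) :
  T (MVB n.+1 \Po 'X^2) = 'X^(n.*2.+2) /\
  T ('X * (MVb n \Po 'X^2)) = 'X^(n.*2.+1).
Proof.
have X_reg : GRing.lreg ('X : {poly rat}) by apply/lregP; rewrite polyX_eq0.
elim: n => [|n [IHB IHb]].
  rewrite MVB1 MVb0 comp_polyX comp_polyC mulr1 -['X in X in _ /\ X]expr1 !hT.
  by rewrite (Qtilde_odd 0) (Qtilde_even 0) !big_ord1 !signed_ballot0 !scale1r.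
(* This half comes first because [MVBS] needs it. Both corrections in [T_mulX] vanish: the known
   image has degree at least 2, and the argument has no constant term. *)
have b_next : T ('X * (MVb n.+1 \Po 'X^2)) = 'X^(n.+1.*2.+1).
  rewrite MVbS comp_polyD mulrDr linearD /= IHb; apply: X_reg.
  rewrite mulrDr (T_mulX T hT) IHB coefXn scale0r add0r.
  have -> : (MVB n.+1 \Po 'X^2)`_0 = 0.
    rewrite -horner_coef0 horner_comp hornerXn expr0n horner_coef0 coef_MVB.
    by rewrite bin_small // addn0.
  by rewrite addr0 doubleS !exprS; ring.
split=> //.
rewrite MVBS comp_polyD linearD /= IHB comp_polyM comp_polyX expr2 -mulrA.
apply: X_reg; rewrite mulrDr (T_mulX T hT) b_next coefXn scale0r add0r.
by rewrite coefXM addr0 !doubleS !exprS; ring.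
Qed.

Theorem corollary5p2 (T : {linear {poly rat} -> {poly rat}})
    (hT : forall n : nat, T 'X^n = Qtilde n) :
  (forall n : nat, (1 <= n)%N -> T (MVB n \Po 'X^2) = 'X^(2 * n)) /\
  (forall n : nat, T ('X * (MVb n \Po 'X^2)) = 'X^(2 * n + 1)).
Proof.
split=> [[|n] // _|n]; have [TB Tb] := T_MorganVoyce T hT n.
  by rewrite TB mul2n.
by rewrite Tb mul2n addn1.
Qed.
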